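(* For any necessity lattice $(L,\Box)$, $\mathsf{FI}(L,\Box)$ is a CA frame, and the map $a\mapsto\widehat{a}$ is (i) an embedding of $(L,\Box)$ into $(\mathfrak{L}(\mathsf{FI}(L)),\Box_R)$ and (ii) an isomorphism from $(L,\Box)$ to the subalgebra of $(\mathfrak{L}(\mathsf{FI}(L)),\Box_R)$ consisting of those $c_\vartriangleleft$-fixpoints that are compact open in the space $\mathsf{S}(L)$.
   Context: A compatibility frame is a pair $(X,\vartriangleleft)$ with $X$ a nonempty set and $\vartriangleleft$ a reflexive binary relation on $X$. Write $y\vartriangleright x$ for $x\vartriangleleft y$, and for $A\subseteq X$ let $c_\vartriangleleft(A)=\{x\in X\mid \forall x'\vartriangleleft x\ \exists x''\vartriangleright x':\ x''\in A\}$. This is a closure operator on $\wp(X)$. A $c_\vartriangleleft$-fixpoint is an $A\subseteq X$ with $c_\vartriangleleft(A)=A$. $\mathfrak{L}(X,\vartriangleleft)$ is the complete lattice of $c_\vartriangleleft$-fixpoints ordered by $\subseteq$ (meets are intersections; $\bigvee A_i=c_\vartriangleleft(\bigcup A_i)$). A necessity lattice is a pair $(L,\Box)$ with $L$ a lattice and $\Box$ a unary operation with $\Box(a\wedge b)=\Box a\wedge\Box b$ for all $a,b$, and $\Box1=1$ if $L$ has a maximum $1$. A compatibility and accessibility (CA) frame is a triple $(X,\vartriangleleft,R)$ where $(X,\vartriangleleft)$ is a compatibility frame and $R$ is a binary relation on $X$ such that for every $c_\vartriangleleft$-fixpoint $A\subseteq X$, the set $\Box_R A=\{x\in X\mid R(x)\subseteq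 A\}$ is also a $c_\vartriangleleft$-fixpoint, where $R(x)=\{y\in X\mid xRy\}$. $\mathsf{FI}(L)=(X,\vartriangleleft)$, where $X$ is the set of all pairs $(F,I)$ with $F$ a filter in $L$, $I$ an ideal in $L$, and $F\cap I=\varnothing$; and $(F,I)\vartriangleleft(F',I')$ iff $I\cap F'=\varnothing$. $\mathsf{FI}(L,\Box)=(X,\vartriangleleft,R)$, where $(F,I)R(F',I')$ iff for all $a\in L$, $\Box a\in F$ implies $a\in F'$. For $a\in L$, $\widehat{a}=\{(F,I)\in X\mid a\in F\}$. $\mathsf{S}(L)$ is $\mathsf{FI}(L)$ endowed with the topology on $X$ generated by $\{\widehat{a}\mid a\in L\}$.
   Formalization: The lattice L is assumed to have at least two elements (otherwise FI(L) is empty and not a compatibility frame), and part (ii) assumes L has a minimum (otherwise the empty set is a compact open fixpoint that is no â); filters and ideals are nonempty. *)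

(* Defs.v *)
From HB Require Import structures.
From mathcomp Require Import all_boot all_order.
From mathcomp Require Import boolp classical_sets functions topology.

Set Implicit Arguments.
Unset Strict Implicit.
Unset Printing Implicit Defensive.

Local Open Scope classical_set_scope.

Definition compatibility_frame (X : Type) (cmp : X -> X -> Prop) : Prop :=
  (exists x : X, True) /\ (forall x, cmp x x).

(** [cmp x y] stands for [x ◁ y], so [x''] ranges over the points with
    [x' ◁ x'']. *)
Definition compat_closure (X : Type) (cmp : X -> X -> Prop) (A : set X) :
    set X :=
  [set x | forall x', cmp x' x -> exists2 x'', cmp x' x'' & A x''].

Definition compat_fixpoint (X : Type) (cmp : X -> X -> Prop) : set (set X) :=
  [set A | compat_closure cmp A = A].

Section ClosureOperator.
Variables (X : Type) (cmp : X -> X -> Prop).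
Local Notation c := (compat_closure cmp).

Lemma sub_compat_closure (A : set X) : A `<=` c A.
Proof. by move=> x Ax x' x'x; exists x. Qed.

Lemma compat_closureS (A B : set X) : A `<=` B -> c A `<=` c B.
Proof. by move=> AB x cAx x' /cAx[x'' ? /AB]; exists x''. Qed.

Lemma compat_closureK (A : set X) : compat_fixpoint cmp (c A).
Proof.
apply/seteqP; split; last exact: sub_compat_closure.
by move=> x cAx x' /cAx[x'' x'x'']; apply.
Qed.

Lemma compat_fixpointI (A B : set X) :
  compat_fixpoint cmp A -> compat_fixpoint cmp B ->
  compat_fixpoint cmp (A `&` B).
Proof.
move=> cA cB; apply/seteqP; split; last exact: sub_compat_closure.
move=> x cABx; split.
- by rewrite -cA; apply: compat_closureS cABx => y [].
- by rewrite -cB; apply: compat_closureS cABx => y [].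
Qed.

End ClosureOperator.

Fact fixpoints_display : Order.disp_t. Proof. by []. Qed.

Record fixpoints (X : Type) (cmp : X -> X -> Prop) : Type := MkFixpoint {
  fix_set : set X;
  fix_setP : compat_fixpoint cmp fix_set }.

Section FixpointLattice.
Variables (X : Type) (cmp : X -> X -> Prop).
Implicit Types A B C : fixpoints cmp.

Lemma fix_set_inj : injective (@fix_set X cmp).
Proof.
move=> [A cA] [B cB] /= AB; case: _ / AB cB => cB.
by congr MkFixpoint; exact: Prop_irrelevance.
Qed.

HB.instance Definition _ := gen_eqMixin (fixpoints cmp).
HB.instance Definition _ := gen_choiceMixin (fixpoints cmp).

Definition fix_le A B : bool := `[< fix_set A `<=` fix_set B >].

Lemma fix_le_refl : reflexive fix_le.
Proof. by move=> A; apply/asboolP. Qed.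

Lemma fix_le_anti : antisymmetric fix_le.
Proof.
move=> A B /andP[/asboolP AB /asboolP BA].
by apply: fix_set_inj; apply/seteqP.
Qed.

Lemma fix_le_trans : transitive fix_le.
Proof.
move=> B A C /asboolP AB /asboolP BC.
by apply/asboolP; exact: subset_trans BC.
Qed.

HB.instance Definition _ :=
  Order.Le_isPOrder.Build fixpoints_display (fixpoints cmp)
    fix_le_refl fix_le_anti fix_le_trans.

Lemma fix_leP A B : reflect (fix_set A `<=` fix_set B) (A <= B)%O.
Proof. exact: asboolP. Qed.

Definition fix_meet A B : fixpoints cmp :=
  MkFixpoint (compat_fixpointI (fix_setP A) (fix_setP B)).

Definition fix_join A B : fixpoints cmp :=
  MkFixpoint (compat_closureK cmp (fix_set A `|` fix_set B)).

Lemma fix_meetP A B C :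
  (A <= fix_meet B C)%O = ((A <= B)%O && (A <= C)%O).
Proof.
apply/fix_leP/andP => [|[/fix_leP AB /fix_leP AC]]; last by rewrite subsetI.
by rewrite /= subsetI => -[? ?]; split; exact/fix_leP.
Qed.

Lemma fix_joinP A B C :
  (fix_join A B <= C)%O = ((A <= C)%O && (B <= C)%O).
Proof.
apply/fix_leP/andP => [|[/fix_leP AC /fix_leP BC]] /=.
- move=> /(subset_trans (@sub_compat_closure _ cmp _)).
  by rewrite subUset => -[? ?]; split; exact/fix_leP.
- rewrite -[X in _ `<=` X](fix_setP C); apply: compat_closureS.
  by rewrite subUset.
Qed.

HB.instance Definition _ :=
  Order.POrder_MeetJoin_isLattice.Build fixpoints_display (fixpoints cmp)
    fix_meetP fix_joinP.

End FixpointLattice.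

Definition acc_box (X : Type) (R : X -> X -> Prop) (A : set X) : set X :=
  [set x | R x `<=` A].

Definition CA_frame (X : Type) (cmp R : X -> X -> Prop) : Prop :=
  compatibility_frame cmp /\
  (forall A, compat_fixpoint cmp A -> compat_fixpoint cmp (acc_box R A)).

Definition fix_box (X : Type) (cmp R : X -> X -> Prop) (ca : CA_frame cmp R)
    (A : fixpoints cmp) : fixpoints cmp :=
  MkFixpoint (proj2 ca (fix_set A) (fix_setP A)).

Section LatticeWithBox.
Local Open Scope order_scope.

(** A [latticeType] need not have bounds, so the maximum is not [\top]. *)
Definition necessity_lattice d (L : latticeType d) (box : L -> L) : Prop :=
  Order.meet_morphism box /\
  (forall t : L, (forall a, a <= t) -> box t = t).

Definition box_homomorphism d (L : latticeType d) (box : L -> L)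
    d' (L' : latticeType d') (box' : L' -> L') (h : L -> L') : Prop :=
  [/\ Order.meet_morphism h, Order.join_morphism h &
      {morph h : a / box a >-> box' a}].

Definition box_embedding d (L : latticeType d) (box : L -> L)
    d' (L' : latticeType d') (box' : L' -> L') (h : L -> L') : Prop :=
  box_homomorphism box box' h /\ injective h.

Definition box_subalgebra d (L : latticeType d) (box : L -> L)
    (S : set L) : Prop :=
  [/\ forall a b, S a -> S b -> S (a `&` b),
      forall a b, S a -> S b -> S (a `|` b) &
      forall a, S a -> S (box a)].

Definition box_isomorphism_onto d (L : latticeType d) (box : L -> L)
    d' (L' : latticeType d') (box' : L' -> L') (S : set L')
    (h : L -> L') : Prop :=
  [/\ box_subalgebra box' S, box_homomorphism box box' h &
      set_bij [set: L] S h].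

End LatticeWithBox.

Section FilterIdeal.
Local Open Scope order_scope.

(** Filters and ideals are nonempty; properness is automatic for the members
    of a disjoint pair. *)
Definition order_filter d (L : latticeType d) (F : set L) : Prop :=
  [/\ F !=set0, forall a b, F a -> a <= b -> F b &
      forall a b, F a -> F b -> F (a `&` b)].

Definition order_ideal d (L : latticeType d) (I : set L) : Prop :=
  [/\ I !=set0, forall a b, I b -> a <= b -> I a &
      forall a b, I a -> I b -> I (a `|` b)].

End FilterIdeal.

Record FI d (L : latticeType d) : Type := MkFI {
  fi_filter : set L;
  fi_ideal : set L;
  fi_filterP : order_filter fi_filter;
  fi_idealP : order_ideal fi_ideal;
  fi_disjoint : fi_filter `&` fi_ideal = set0 }.

Definition fi_compat d (L : latticeType d) (x y : FI L) : Prop :=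
  fi_ideal x `&` fi_filter y = set0.

Definition fi_acc d (L : latticeType d) (box : L -> L) (x y : FI L) : Prop :=
  forall a : L, fi_filter x (box a) -> fi_filter y a.

Definition hat d (L : latticeType d) (a : L) : set (FI L) :=
  [set x | fi_filter x a].

(** The subbase is indexed by itself because the index type has to be
    pointed, which [L] is not. *)

HB.instance Definition _ d (L : latticeType d) := gen_eqMixin (FI L).
HB.instance Definition _ d (L : latticeType d) := gen_choiceMixin (FI L).
HB.instance Definition _ d (L : latticeType d) :=
  isSubBaseTopological.Build (FI L) (range (@hat d L)) id.

Definition compact_open_fixpoints d (L : latticeType d) :
    set (fixpoints (@fi_compat d L)) :=
  [set A | cover_compact (fix_set A) /\ open (fix_set A)].
Arguments compact_open_fixpoints {d} L.

(* Main.v *)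
Require Import Defs.
From mathcomp Require Import all_boot all_order.
From mathcomp Require Import boolp classical_sets topology.

(** A pair (F, I) is a partial verdict on the lattice: F collects the elements
    held true, I those held false.  The compatibility (F, I) ◁ (F', I') only
    asks that nothing held false by the first be held true by the second, so
    the closure operator sees F through the ideals disjoint from it.

    Every separation is made by a pair built from principal filters and
    ideals.  A point where a is not true is tested by the ideal below a, hence
    [hat a] is a fixpoint ([hat_fixpoint]).  If a ∨ b is true at x, then an
    ideal disjoint from the filter of x misses a or b, because it is closed
    under joins; so [hat (a ∨ b)] is the closure of the union ([hat_join]).

    For the box there is one construction, [exists_acc_ideal]: as box commutes
    with meets, {b | box b ∈ F} is a filter, the least one that a successor can
    have, and it can be paired with any ideal disjoint from it.  Applied to the
    ideal below a, it gives [hat (box a) = acc_box R (hat a)] ([hat_box]).  For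
    the frame condition ([fi_CA_frame]), an ideal I testing a successor y of x
    is pulled back to the ideal generated by {box b | b ∈ I}, which tests x;
    the witness obtained for x is pushed back to the successors by the same
    construction.  The delicate point is that without a maximum {b | box b ∈ F}
    may be empty; then every pair is a successor.

    Topologically, an open set that contains x contains a whole [hat b] with b
    true at x ([open_hat_sub]).  A nonempty [hat a] has a point whose filter is
    the principal one, and any open set containing that point contains
    [hat a]; hence [hat a] is compact.  Conversely, a compact open set is a
    finite union of sets [hat b], and if it is a fixpoint then it contains
    [hat] of their join, hence is equal to it.  The empty union is [hat] of the
    minimum. *)

Set Implicit Arguments.
Unset Strict Implicit.
Unset Printing Implicit Defensive.

Import Order.TTheory.
Local Open Scope classical_set_scope.
Local Open Scope order_scope.

(** * Pairs of disjoint filters and ideals *)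

Section FilterIdealPairs.
Context d (L : latticeType d).
Implicit Types (a b : L) (x y : FI L) (F I : set L) (A : set (FI L)).

Lemma order_filter_up a : order_filter [set b | a <= b].
Proof.
split=> [|b c|b c] /=; first by exists a => /=.
- exact: le_trans.
- by rewrite lexI => -> ->.
Qed.

Lemma order_ideal_down a : order_ideal [set b | b <= a].
Proof.
split=> [|b c|b c] /=; first by exists a => /=.
- by move=> ca bc; exact: le_trans ca.
- by rewrite leUx => -> ->.
Qed.

Lemma fi_filter_le x a b : fi_filter x a -> a <= b -> fi_filter x b.
Proof. by case: (fi_filterP x) => _ + _; apply. Qed.

Lemma fi_ideal_le x a b : fi_ideal x b -> a <= b -> fi_ideal x a.
Proof. by case: (fi_idealP x) => _ + _; apply. Qed.

Lemma fi_filterNideal x a : fi_filter x a -> ~ fi_ideal x a.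
Proof. by move=> xa x'a; rewrite -[False]/(set0 a) -(fi_disjoint x). Qed.

Lemma exists_pair F I : order_filter F -> order_ideal I ->
    (forall a, F a -> ~ I a) ->
  exists x, fi_filter x = F /\ fi_ideal x = I.
Proof.
move=> Ff Ii FI0; have FI_disj : F `&` I = set0.
  by rewrite -subset0 => a [/FI0].
by exists (MkFI Ff Ii FI_disj).
Qed.

Lemma exists_pair_up a I : order_ideal I -> ~ I a ->
  exists x, fi_filter x = [set b | a <= b] /\ fi_ideal x = I.
Proof.
move=> Ii nIa; apply: exists_pair => //; first exact: order_filter_up.
by move=> b /= ab Ib; apply: nIa; case: Ii => _ + _; apply; eauto.
Qed.

Lemma exists_pair_down x a : ~ fi_filter x a ->
  exists y, fi_filter y = fi_filter x /\ fi_ideal y = [set b | b <= a].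
Proof.
move=> nxa; apply: exists_pair; first exact: fi_filterP.
  exact: order_ideal_down.
by move=> b xb /= /(fi_filter_le xb).
Qed.

Lemma fi_compatP x y :
  fi_compat x y <-> forall a, fi_ideal x a -> ~ fi_filter y a.
Proof.
rewrite /fi_compat -subset0; split=> [xy a xa ya|xy a [/xy]//].
exact: (xy a).
Qed.

Lemma fi_compat_refl x : fi_compat x x.
Proof. by apply/fi_compatP => a xa /fi_filterNideal. Qed.

(** The nontriviality of the lattice is exactly what makes a pair exist. *)
Lemma fi_compatibility_frame :
  (exists a b, a <> b) -> compatibility_frame (@fi_compat d L).
Proof.
move=> [a [b nab]]; split; last exact: fi_compat_refl.
have sep (u v : L) : ~~ (u <= v) -> exists x : FI L, True.
  move=> /negP uv.
  by have [x _] := exists_pair_up (order_ideal_down v) uv; exists x.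
have [ab|] := boolP (a <= b); last exact: sep.
apply: (sep b a); apply/negP => ba.
by apply: nab; apply: le_anti; rewrite ab ba.
Qed.

(** * The sets of pairs whose filter contains a given element *)

Lemma hat_sub a b : hat a `<=` hat b -> a <= b.
Proof.
move=> hab; apply/negPn/negP => /negP ab.
have [x [xF xI]] := exists_pair_up (order_ideal_down b) ab.
by apply: ab; have := hab x; rewrite /hat /= xF; apply=> /=.
Qed.

Lemma hat_fixpoint a : compat_fixpoint (@fi_compat d L) (hat a).
Proof.
apply/seteqP; split; last exact: sub_compat_closure.
move=> x cax; apply: contrapT => nxa.
have [x' [x'F x'I]] := exists_pair_down nxa.
have x'x : fi_compat x' x.
  by apply/fi_compatP => b; rewrite -x'F => x'b /fi_filterNideal.
have [y /fi_compatP x'y ya] := cax _ x'x.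
by apply: (x'y a) => //; rewrite x'I /=.
Qed.

Lemma hatI a b : hat (a `&` b) = (hat a `&` hat b)%classic.
Proof.
apply/seteqP; split=> x; rewrite /hat /=.
  by move=> xab; split; apply: fi_filter_le xab _; rewrite ?leIl ?leIr.
by case: (fi_filterP x) => _ _ xI [xa xb]; exact: xI.
Qed.

Lemma hat_join a b :
  hat (a `|` b) = compat_closure (@fi_compat d L) (hat a `|` hat b)%classic.
Proof.
apply/seteqP; split=> [x xab x' /fi_compatP x'x|].
  have [x'a|nx'a] := pselect (fi_ideal x' a); last first.
    have [y [yF yI]] := exists_pair_up (fi_idealP x') nx'a.
    exists y; last by left; rewrite /hat /= yF /=.
    by apply/fi_compatP => c; rewrite -yI => yc /fi_filterNideal.
  have nx'b : ~ fi_ideal x' b.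
    by case: (fi_idealP x') => _ _ x'U x'b; exact: (x'x _ (x'U _ _ x'a x'b)).
  have [y [yF yI]] := exists_pair_up (fi_idealP x') nx'b.
  exists y; last by right; rewrite /hat /= yF /=.
  by apply/fi_compatP => c; rewrite -yI => yc /fi_filterNideal.
rewrite -[X in _ `<=` X]hat_fixpoint; apply: compat_closureS.
by move=> x [] xa; apply: fi_filter_le xa _; rewrite ?leUl ?leUr.
Qed.

Lemma hat_join_sub A a b : compat_fixpoint (@fi_compat d L) A ->
  hat a `<=` A -> hat b `<=` A -> hat (a `|` b) `<=` A.
Proof.
move=> <- aA bA; rewrite hat_join -[X in _ `<=` X]compat_closureK.
by apply: compat_closureS; rewrite subUset.
Qed.

(** * Compact open sets *)

Lemma open_hat a : open (hat a : set (FI L)).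
Proof.
exists [set hat a]; last by rewrite bigcup_set1.
by move=> _ ->; apply: filter.finI_from1; exists a.
Qed.

(** The filter of x is closed under finite meets, which makes the subbase
    behave as a base; as it is nonempty, the empty intersection is covered
    too. *)
Lemma subbase_hat_sub x (s : seq (set (FI L))) :
    (forall A, A \in s -> range (@hat d L) A /\ A x) ->
  exists2 b, fi_filter x b & forall A, A \in s -> hat b `<=` A.
Proof.
elim: s => [|C t IH] xs; first by have [[b xb] _ _] := fi_filterP x; exists b.
have [|b xb bt] := IH; first by move=> B Bt; apply: xs; rewrite inE Bt orbT.
have [[c _ cC] Cx] := xs C (mem_head _ _).
have xbc : hat (b `&` c) x by rewrite hatI; split; rewrite ?cC.
exists (b `&` c); first exact: xbc.
by rewrite hatI => B; rewrite inE => /predU1P[->|/bt bB] y [yb yc];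
  [rewrite -cC|exact: bB].
Qed.

Lemma open_hat_sub A x : open A -> A x ->
  exists2 b, fi_filter x b & hat b `<=` A.
Proof.
have -> : open A = exists2 D : set (set (FI L)),
    D `<=` filter.finI_from (range (@hat d L)) id & \bigcup_(B in D) B = A.
  by [].
move=> [D Dfin <-] [B /[dup] DB /Dfin[s s_hat sB] Bx]; rewrite -sB in Bx.
have [C Cs|b xb bs] := @subbase_hat_sub x (finmap.enum_fset s).
  by split; [have := s_hat C Cs; rewrite inE|exact: Bx].
by exists b => // y yb; exists B => //; rewrite -sB => C /bs; exact.
Qed.

Lemma cover_compact_hat a : cover_compact (hat a : set (FI L)).
Proof.
move=> I D f fop acov.
have [[x xa]|a0] := pselect (exists x, hat a x); last first.
  exists finmap.fset0 => // x xa; case: a0; by exists x.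
have [y [yF yI]] := exists_pair_up (fi_idealP x) (fi_filterNideal xa).
have [|i Di yi] := acov y; first by rewrite /hat /= yF /=.
have [b yb bi] := open_hat_sub (fop i Di) yi.
exists (finmap.fset1 i).
  by move=> j; rewrite finmap.in_fset1 => /eqP ->; rewrite inE.
move=> u ua; exists i; first by rewrite /= finmap.in_fset1.
by apply/bi/(fi_filter_le ua); rewrite yF in yb.
Qed.

Lemma hat_min z : (forall a, z <= a) -> hat z `<=` set0.
Proof.
move=> zmin x xz; have [[i xi] _ _] := fi_idealP x.
exact/(fi_filterNideal (fi_filter_le xz (zmin i))).
Qed.

Lemma compact_open_fixpoint_hat z A : (forall a, z <= a) ->
    compat_fixpoint (@fi_compat d L) A -> cover_compact A -> open A ->
  exists a, A = hat a.
Proof.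
move=> zmin Afix Acomp Aopen.
have [||s sA As] := Acomp L [set b | hat b `<=` A] (@hat d L).
- by move=> b _; exact: open_hat.
- by move=> x /(open_hat_sub Aopen)[b xb bA]; exists b.
have {}sA b : b \in finmap.enum_fset s -> hat b `<=` A by move=> /sA; rewrite inE.
suff [a aA sa] : exists2 a, hat a `<=` A &
    forall b, b \in finmap.enum_fset s -> b <= a.
  exists a; apply/seteqP; split=> // x /As[b bs xb].
  exact: fi_filter_le xb (sa b bs).
elim: (finmap.enum_fset s) sA => [_|b t IH bt].
  by exists z => // x /(hat_min zmin).
have [|a aA ta] := IH; first by move=> c ct; apply: bt; rewrite inE ct orbT.
exists (b `|` a); first by apply: hat_join_sub => //; apply/bt/mem_head.
move=> c; rewrite inE => /predU1P[->|/ta ca]; first exact: leUl.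
exact: le_trans ca (leUr _ _).
Qed.

End FilterIdealPairs.

(** * The accessibility relation *)

Section Accessibility.
Context d (L : latticeType d) (box : L -> L) (necL : necessity_lattice box).
Implicit Types (a b : L) (x y : FI L) (I : set L).

Lemma necessity_mono : {homo box : a b / a <= b}.
Proof. by case: necL => boxI _ a b; rewrite !leEmeet -boxI => /eqP ->. Qed.

Lemma order_filter_preim_box x : (exists b, fi_filter x (box b)) ->
  order_filter [set b | fi_filter x (box b)].
Proof.
have [_ _ xI] := fi_filterP x; split=> //= [a b xa /necessity_mono|a b xa xb].
  exact: fi_filter_le.
by have [-> _] := necL; exact: xI.
Qed.

(** The least filter of a successor of x, {b | box b ∈ F}, is paired with I.
    When it is empty, accessibility from x is no constraint and any filter
    disjoint from I will do; the element outside I provides one. *)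
Lemma exists_acc_ideal x I : order_ideal I -> (exists a, ~ I a) ->
    (forall b, fi_filter x (box b) -> ~ I b) ->
  exists2 y, fi_acc box x y & fi_ideal y = I.
Proof.
move=> Ii [a nIa] xI; have [xne|x0] := pselect (exists b, fi_filter x (box b)).
  have [y [yF yI]] := exists_pair (order_filter_preim_box xne) Ii xI.
  by exists y => // b; rewrite yF.
have [y [_ yI]] := exists_pair_up Ii nIa.
by exists y => // b xb; case: x0; exists b.
Qed.

Lemma hat_box a : hat (box a) = acc_box (fi_acc box) (hat a).
Proof.
apply/seteqP; split=> [x xa y|x xa]; first exact.
apply: contrapT => nxa.
have [|b xb /= ba|y xy yI] :=
  exists_acc_ideal (x := x) (order_ideal_down a).
  (* Otherwise a is the maximum, and so is box a: it lies in every filter. *)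
- apply: contrapT => amax; have {}amax b : b <= a.
    by apply: contrapT => ba; apply: amax; exists b.
  have [[b xb] _ _] := fi_filterP x; apply: nxa; have [_ ->//] := necL.
  exact: fi_filter_le xb (amax b).
- exact: nxa (fi_filter_le xb (necessity_mono ba)).
- by apply: (@fi_filterNideal _ _ y a); [exact: xa|rewrite yI /=].
Qed.

(** The ideal generated by the box of an ideal: the test on a point that
    mirrors a test of its successors. *)
Lemma order_ideal_box I : order_ideal I ->
  order_ideal [set c | exists2 b, I b & c <= box b].
Proof.
move=> [[i Ii] _ IU]; split=> /=.
- by exists (box i); exists i.
- by move=> a b [c Ic bc] ab; exists c => //; exact: le_trans bc.
- move=> a b [c Ic ac] [e Ie be]; exists (c `|` e); first exact: IU.
  by rewrite leUx (le_trans ac) ?(le_trans be) ?necessity_mono ?leUl ?leUr.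
Qed.

Lemma fi_CA_frame : (exists a b : L, a <> b) ->
  CA_frame (@fi_compat d L) (fi_acc box).
Proof.
move=> nontrivial; split; first exact: fi_compatibility_frame.
move=> A Afix; apply/seteqP; split; last exact: sub_compat_closure.
move=> x cx y xy; rewrite -Afix => y' /fi_compatP y'y.
have [|x' [x'F x'I]] :=
    exists_pair (fi_filterP x) (order_ideal_box (fi_idealP y')).
  by move=> c xc [b y'b] /(fi_filter_le xc)/xy; exact: y'y.
have [|u /fi_compatP x'u uA] := cx x'.
  by apply/fi_compatP => c; rewrite -x'F => x'c /fi_filterNideal.
have [||v uv vI] := exists_acc_ideal (x := u) (fi_idealP y').
- by have [[b y'b] _ _] := fi_filterP y'; exists b; exact: fi_filterNideal.
- by move=> b ub y'b; apply: (x'u (box b)) => //; rewrite x'I; exists b.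
- exists v; last exact: uA.
  by apply/fi_compatP => b; rewrite -vI => vb /fi_filterNideal.
Qed.

End Accessibility.

Theorem proposition4p10 (d : Order.disp_t) (L : latticeType d) (box : L -> L)
    (nontrivial : exists a b : L, a <> b) (necL : necessity_lattice box) :
  exists (ca : CA_frame (@fi_compat d L) (fi_acc box))
         (h : L -> fixpoints (@fi_compat d L)),
    [/\ forall a : L, fix_set (h a) = hat a,
        box_embedding box (fix_box ca) h &
        (exists z : L, forall a : L, (z <= a)%O) ->
        box_isomorphism_onto box (fix_box ca) (compact_open_fixpoints L) h].
Proof.
set ca := fi_CA_frame necL nontrivial.
pose h a := MkFixpoint (@hat_fixpoint _ L a).
have hI : Order.meet_morphism h.
  by move=> a b; apply: fix_set_inj; exact: hatI.
have hU : Order.join_morphism h.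
  by move=> a b; apply: fix_set_inj; exact: hat_join.
have hbox : {morph h : a / box a >-> fix_box ca a}.
  by move=> a; apply: fix_set_inj; exact: hat_box.
have h_inj : injective h.
  move=> a b /(congr1 (@fix_set _ _)) /= hab.
  by apply: le_anti; rewrite !hat_sub ?hab.
exists ca, h; split=> // -[z zmin].
have h_co a : compact_open_fixpoints L (h a).
  by split; [exact: cover_compact_hat|exact: open_hat].
have h_onto A : compact_open_fixpoints L A -> exists a, h a = A.
  move=> [Acomp Aopen].
  have [a Aa] := compact_open_fixpoint_hat zmin (fix_setP A) Acomp Aopen.
  by exists a; apply: fix_set_inj.
split=> //.
- split=> [_ _ /h_onto[a <-] /h_onto[b <-]|_ _ /h_onto[a <-] /h_onto[b <-]|].
  + by rewrite -hI.
  + by rewrite -hU.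
  + by move=> _ /h_onto[a <-]; rewrite -hbox.
- split=> [a _|a b _ _ /h_inj//|A /h_onto[a <-]]; [exact: h_co|by exists a].
Qed.
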